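(* For $j=1,2$ let $u_{0,j}\in H^1(\mathbb R)$ and let $\mu_{0,j}$ be a nonnegative finite Radon measure on $\mathbb R$ whose absolutely continuous part is $u_{0,j}'^2\,dx$; put $C_j=\mu_{0,j}(\mathbb R)$ and $F_{0,j}(x)=\mu_{0,j}((-\infty,x))$. Assume $$\int_{-\infty}^0F_{0,j}(x)\,dx+\int_0^\infty\big(C_j-F_{0,j}(x)\big)\,dx<\infty,\qquad j=1,2.$$ Let $(u_j(t),\mu_j(t))$ be the conservative solution of the Hunter--Saxton equation with initial data $(u_{0,j},\mu_{0,j})$, and for $t\ge0$, $\eta\in(0,C_j]$ let $$\chi_j(t,\eta)=\sup\{x\mid \mu_j(t)((-\infty,x))<\eta\},\qquad \mathcal U_j(t,\eta)=u_j(t,\chi_j(t,\eta)).$$ Define $$d\big((u_1(t),\mu_1(t)),(u_2(t),\mu_2(t))\big)=\|\mathcal U_1(t,C_1\,\cdot)-\mathcal U_2(t,C_2\,\cdot)\|_{L^\infty([0,1])}+\|\chi_1(t,C_1\,\cdot)-\chi_2(t,C_2\,\cdot)\|_{L^1([0,1])}+|C_1-C_2|.$$ Then for all $t\ge0$, $$d\big((u_1(t),\mu_1(t)),(u_2(t),\mu_2(t))\big)\le\Big(1+t+\frac18t^2\Big)\,d\big((u_{0,1},\mu_{0,1}),(u_{0,2},\mu_{0,2})\big).$$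
   Context: The (integrated, augmented) Hunter--Saxton system is $u_t+uu_x=\frac14\int_{-\infty}^x d\mu-\frac14\int_x^\infty d\mu$, $\mu_t+(u\mu)_x=0$. Its conservative solution with initial data $(u_0,\mu_0)$ (with $C=\mu_0(\mathbb R)$) is defined as follows. Let $F_0(x)=\mu_0((-\infty,x))$ and define $\bar y_0(\xi)=\sup\{x\mid x+F_0(x)<\xi\}$, $\bar U_0(\xi)=u_0(\bar y_0(\xi))$, $\bar H_0(\xi)=\xi-\bar y_0(\xi)$ for $\xi\in\mathbb R$. For $t\ge0$ set $\bar y(t,\xi)=\frac14(\bar H_0(\xi)-\frac12C)t^2+\bar U_0(\xi)t+\bar y_0(\xi)$, $\bar U(t,\xi)=\frac12(\bar H_0(\xi)-\frac12C)t+\bar U_0(\xi)$, $\bar H(t,\xi)=\bar H_0(\xi)$. Then $\xi\mapsto\bar y(t,\xi)$ is nondecreasing and onto $\mathbb R$, and the conservative solution is $u(t,x)=\bar U(t,\xi)$ for any $\xi$ with $\bar y(t,\xi)=x$, and $\mu(t)=\bar y(t,\cdot)_\#(\bar H_\xi\,d\xi)$ (push-forward measure). In particular $\mu(t)(\mathbb R)=C$ for all $t$. *)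

(* Defs.v *)
From HB Require Import structures.
From mathcomp Require Import all_boot all_order all_algebra.
From mathcomp Require Import all_classical all_reals all_analysis.
Set Implicit Arguments. Unset Strict Implicit. Unset Printing Implicit Defensive.
Import Order.TTheory GRing.Theory Num.Theory.
Import numFieldNormedType.Exports.
Local Open Scope classical_set_scope.
Local Open Scope ring_scope.

Section HS.
Variable R : realType.
Local Notation leb := (@lebesgue_measure R).

(* u belongs to H^1(R) (continuous representative), with weak derivative du:
   u, du are in L^2(R) and u(b) - u(a) = int_a^b du. *)
Definition H1_with_deriv (u du : R -> R) : Prop :=
  measurable_fun setT du /\
  (\int[leb]_(x in setT) ((u x) ^+ 2)%:E < +oo)%E /\
  (\int[leb]_(x in setT) ((du x) ^+ 2)%:E < +oo)%E /\
  (forall a b, a <= b -> ((u b - u a)%:E = \int[leb]_(x in [set` `[a, b]]) (du x)%:E)%E).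

Definition ac_part_is (mu0 : {measure set R -> \bar R}) (du : R -> R) : Prop :=
  exists nu : {measure set R -> \bar R},
    (exists N : set R, measurable N /\ leb N = 0%E /\ nu (~` N) = 0%E) /\
    (forall A : set R, measurable A ->
       mu0 A = (\int[leb]_(x in A) ((du x) ^+ 2)%:E + nu A)%E).

Definition Fcum (mu : set R -> \bar R) (x : R) : R := fine (mu [set` `]-oo, x[]).

Definition mass (mu : set R -> \bar R) : R := fine (mu setT).

Definition tail_condition (mu0 : set R -> \bar R) : Prop :=
  (\int[leb]_(x in [set` `]-oo, (0%R : R)]]) (Fcum mu0 x)%:E
   + \int[leb]_(x in [set` `[(0%R : R), +oo[]) (mass mu0 - Fcum mu0 x)%:E < +oo)%E.

Definition ybar0 (mu0 : set R -> \bar R) (xi : R) : R :=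
  sup [set x | x + Fcum mu0 x < xi].
Definition Ubar0 (u0 : R -> R) (mu0 : set R -> \bar R) (xi : R) : R :=
  u0 (ybar0 mu0 xi).
Definition Hbar0 (mu0 : set R -> \bar R) (xi : R) : R := xi - ybar0 mu0 xi.

Definition ybar (u0 : R -> R) (mu0 : set R -> \bar R) (t xi : R) : R :=
  (Hbar0 mu0 xi - mass mu0 / 2) * t ^+ 2 / 4 + Ubar0 u0 mu0 xi * t + ybar0 mu0 xi.
Definition Ubar (u0 : R -> R) (mu0 : set R -> \bar R) (t xi : R) : R :=
  (Hbar0 mu0 xi - mass mu0 / 2) * t / 2 + Ubar0 u0 mu0 xi.

Definition conservative_solution (u0 : R -> R) (mu0 : set R -> \bar R)
    (u : R -> R -> R) (mu : R -> set R -> \bar R) : Prop :=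
  forall t, 0 <= t ->
    (forall xi, u t (ybar u0 mu0 t xi) = Ubar u0 mu0 t xi) /\
    (forall A : set R, measurable A ->
       (mu t A = \int[leb]_(xi in ybar u0 mu0 t @^-1` A) (derive1 (Hbar0 mu0) xi)%:E)%E).

Definition chi (mu : set R -> \bar R) (eta : R) : R :=
  sup [set x | (mu [set` `]-oo, x[] < eta%:E)%E].
Definition Ucal (u : R -> R) (mu : set R -> \bar R) (eta : R) : R :=
  u (chi mu eta).

Definition Linf01 (f : R -> R) : \bar R :=
  ereal_inf [set M : \bar R |
    leb ([set` `[(0%R : R), 1%R]] `&` [set x | (M < (`|f x|)%:E)%E]) = 0%E].

Definition L1_01 (f : R -> R) : \bar R :=
  (\int[leb]_(x in [set` `[(0%R : R), 1%R]]) (`|f x|)%:E)%E.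

Definition dist (u1 : R -> R) (mu1 : set R -> \bar R)
                (u2 : R -> R) (mu2 : set R -> \bar R) : \bar R :=
  (Linf01 (fun eta => Ucal u1 mu1 (mass mu1 * eta) - Ucal u2 mu2 (mass mu2 * eta))%R
   + L1_01 (fun eta => chi mu1 (mass mu1 * eta) - chi mu2 (mass mu2 * eta))%R
   + (`|mass mu1 - mass mu2|%R)%:E)%E.

End HS.

(* Main.v *)
(* In the Lagrangian variable [xi], set [y = ybar0], [U = Ubar0], [H = Hbar0].
   Expanding [0 <= \int (1 + s * u0')^2] over [(y a, y b)] and using
   [u0'^2 dx <= mu0] gives [0 <= dy + 2 s dU + s^2 dH] for the increments between
   [a <= b] and every [s]: [s = t / 2] shows that [ybar t] is nondecreasing, and
   [s = 1, -1] that [U] is Lipschitz, because [dy + dH = b - a].  Since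
   [\int_(-oo, a] H' = H a], the quantile of [mu t] at the level
   [eta] in [(0, C)] is [ybar t xi] with [xi = chi mu0 eta + eta], the point where
   [y xi = chi mu0 eta] and [H xi = eta].  Hence
     [U_t eta = U_0 eta + t/2 (eta - C/2)],
     [chi_t eta = chi_0 eta + t U_0 eta + t^2/4 (eta - C/2)],
   and the estimate follows by subtracting two such solutions at [eta = C_j e] and
   using [|e - 1/2| <= 1/2]. *)
From HB Require Import structures.
Require Import Defs.
From mathcomp Require Import all_boot all_order all_algebra.
From mathcomp Require Import all_classical all_reals all_analysis.
From mathcomp Require Import measurable_realfun ring lra.
Import Order.TTheory GRing.Theory Num.Theory.
Import numFieldNormedType.Exports.
Local Open Scope classical_set_scope.
Local Open Scope ring_scope.

(** * Integrals modulo null sets, and limits of measures along monotone sequences of sets *)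

Section MeasureTheory.
Set Implicit Arguments.
Unset Strict Implicit.
Context d (T : measurableType d) (R : realType) (mu : {measure set T -> \bar R}).
Local Open Scope ereal_scope.
Import HBNNSimple.

(** Each integral is a supremum over simple functions. Cutting a simple function [h] below [f] down
    to the complement of [N] puts it below [g] everywhere and leaves its integral unchanged. *)
Let ge0_le_integral_off_null (N : set T) (f g : T -> \bar R) :
  measurable N -> mu N = 0 -> (forall x, 0 <= f x) -> (forall x, 0 <= g x) ->
  (forall x, ~ N x -> f x <= g x) -> \int[mu]_x f x <= \int[mu]_x g x.
Proof.
move=> mN N0 f0 g0 fg; rewrite !ge0_integralTE//.
apply: ge_ereal_sup => _ [h /= hf <-].
have mNC : measurable (~` N) by exact: measurableC.
apply: le_ereal_sup_tmp; exists (sintegral mu (proj_nnsfun h mNC)).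
  exists (proj_nnsfun h mNC) => // x; rewrite /= mindicE.
  have [|] := boolP (x \in ~` N).
    by rewrite inE => Nx; rewrite mulr1 (le_trans (hf x))// fg.
  by rewrite mulr0.
rewrite -!integralT_nnsfun le_eqVlt; apply/orP; left; apply/eqP.
apply: ge0_ae_eq_integral => //.
- exact/measurable_EFinP.
- exact/measurable_EFinP.
- by move=> x _; rewrite lee_fin.
- by move=> x _; rewrite lee_fin.
exists N; split => // x /= /not_implyP[_]; apply: contra_notP => Nx.
by rewrite /= mindicE mem_set ?mulr1.
Qed.

(* [f] and [g] need not be measurable: the Lebesgue measure is only defined on
   Borel sets, so [f] may fail to be measurable even when [g] is. *)
Lemma eq_integral_off_null (D N : set T) (f g : T -> \bar R) :
  measurable N -> mu N = 0 -> (forall x, ~ N x -> f x = g x) ->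
  \int[mu]_(x in D) f x = \int[mu]_(x in D) g x.
Proof.
move=> mN N0 fg.
have fgD x : ~ N x -> (f \_ D) x = (g \_ D) x by move=> Nx; rewrite !patchE fg.
rewrite !(integral_mkcond D) integralE [RHS]integralE; congr (_ - _);
  apply/eqP; rewrite eq_le; apply/andP; split;
  apply: (ge0_le_integral_off_null mN) => //= x Nx;
  by rewrite ?funepos.unlock ?funeneg.unlock fgD.
Qed.

Lemma measure_bigcup_le (E : (set T)^nat) c : (forall n, measurable (E n)) ->
  nondecreasing_seq E -> (forall n, mu (E n) <= c) -> mu (\bigcup_n E n) <= c.
Proof.
move=> mE ndE Ec.
have cv := @nondecreasing_cvg_mu _ _ _ mu _ mE (bigcup_measurable (fun k _ => mE k)) ndE.
rewrite -(cvg_lim _ cv)//; apply: lime_le; [exact: cvgP cv|exact: nearW].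
Qed.

Lemma measure_bigcap_ge (E : (set T)^nat) c : (forall n, measurable (E n)) ->
  nonincreasing_seq E -> mu (E 0%N) < +oo -> (forall n, c <= mu (E n)) ->
  c <= mu (\bigcap_n E n).
Proof.
move=> mE niE E0 Ec.
have cv := @nonincreasing_cvg_mu _ _ _ mu _ E0 mE (bigcap_measurableType
   (fun k _ => mE k)) niE.
rewrite -(cvg_lim _ cv)//; apply: lime_ge; [exact: cvgP cv|exact: nearW].
Qed.

End MeasureTheory.

(** * Stieltjes measures and densities of monotone Lipschitz functions *)

Section MonotoneLipschitz.
Set Implicit Arguments.
Unset Strict Implicit.
Variable R : realType.
Local Notation leb := (@lebesgue_measure R).

Lemma continuous_of_lipschitz (f : R -> R) (L : R) :
  (forall x y, x <= y -> `|f y - f x| <= L * (y - x)) -> continuous f.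
Proof.
move=> fL x; apply/cvgrPdist_lt => e e0; near=> y.
(* [L] has no prescribed sign, so [|L| + 1] serves as a positive Lipschitz constant. *)
have L1 : 0 < `|L| + 1 by rewrite ltr_wpDl.
have xy : `|x - y| < e / (`|L| + 1).
  by near: y; apply: cvgr_dist_lt => //; rewrite divr_gt0.
apply: (@le_lt_trans _ _ ((`|L| + 1) * `|x - y|)); last first.
  by rewrite mulrC -ltr_pdivlMr.
have LL : L <= `|L| + 1 by rewrite (le_trans (ler_norm L))// lerDl.
have [le_xy|/ltW le_yx] := leP x y.
- rewrite distrC [`|x - y|]distrC (ger0_norm (_ : 0 <= y - x)) ?subr_ge0//.
  by rewrite (le_trans (fL _ _ le_xy))// ler_wpM2r// subr_ge0.
- rewrite (ger0_norm (_ : 0 <= x - y)) ?subr_ge0//.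
  by rewrite (le_trans (fL _ _ le_yx))// ler_wpM2r// subr_ge0.
Unshelve. all: by end_near. Qed.

Lemma stieltjes_itv_oc (f : cumulative R R) (a b : R) : a <= b ->
  lebesgue_stieltjes_measure f `]a, b]%classic = (f b - f a)%:E.
Proof.
move=> ab; rewrite /lebesgue_stieltjes_measure /measure_extension.
by rewrite measurable_mu_extE/= ?wlength_itv_bnd//; exact: is_ocitv.
Qed.

(* The density is the Radon-Nikodym derivative of the Stieltjes measure of [H],
   which is dominated by the Lebesgue measure since [id - H] is nondecreasing. *)
Lemma nondecreasing_lipschitz_density (H : R -> R) (C : R) :
  {homo H : x y / x <= y} -> (forall x y, x <= y -> H y - H x <= y - x) ->
  (forall x, 0 <= H x <= C) -> (forall e, 0 < e -> exists x, H x < e) ->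
  exists h : R -> R, [/\ measurable_fun setT h, forall x, 0 <= h x,
    forall D : set R, (\int[leb]_(x in D) (derive1 H x)%:E = \int[leb]_(x in D) (h x)%:E)%E,
    forall a, (\int[leb]_(x in [set` `]-oo, a]]) (h x)%:E = (H a)%:E)%E &
    (\int[leb]_(x in setT) (h x)%:E <= C%:E)%E].
Proof.
move=> ndH lipH Hb H0.
have cH : continuous H.
  apply: (@continuous_of_lipschitz _ 1) => x y xy.
  by rewrite mul1r ger0_norm ?subr_ge0 ?ndH// lipH.
have ndY : {homo (fun x => x - H x) : x y / x <= y}.
  by move=> x y xy; have := lipH x y xy; lra.
have cY : continuous (fun x => x - H x).
  by move=> x; apply: cvgB; [exact: cvg_id|exact: cH].
pose fH : cumulative R R := HB.pack H
  (isCumulative.Build R _ R H ndH (right_continuousW cH)).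
pose fY : cumulative R R := HB.pack (fun x : R => x - H x)
  (isCumulative.Build R _ R (fun x => x - H x) ndY (right_continuousW cY)).
pose nu := lebesgue_stieltjes_measure fH.
have nu_oc a b : a <= b -> nu `]a, b]%classic = (H b - H a)%:E.
  exact: stieltjes_itv_oc.
(* Lebesgue measure is the sum of the Stieltjes measures of [H] and [id - H]; by uniqueness it
   suffices to compare them on half-open intervals. *)
have lebE A : measurable A -> leb A = (nu A + lebesgue_stieltjes_measure fY A)%E.
  move=> mA; rewrite -measure_addE; apply: lebesgue_measure_unique => // X.
  move=> [[a b] _ <-] /=; rewrite [RHS]measure_addE.
  have [ab|ba] := leP a b; last first.
    by rewrite set_itv_ge ?measure0 ?adde0// bnd_simp -leNgt ltW.
  rewrite /lebesgue_measure [LHS]stieltjes_itv_oc// [X in (X + _)%E]nu_oc//.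
  by rewrite [X in (_ + X)%E]stieltjes_itv_oc//= -EFinD; congr EFin; lra.
have nu_leb A : measurable A -> (nu A <= leb A)%E.
  by move=> mA; rewrite lebE// leeDl.
have nuT : (nu setT <= C%:E)%E.
  rewrite -(@bigcup_itvT R false false); apply: measure_bigcup_le => [n|m n mn|n].
  - exact: measurable_itv.
  - by apply/subsetPset/subset_itv; rewrite leBSide/= ?lerN2 ler_nat.
  - rewrite [leLHS]nu_oc; last by rewrite (@le_trans _ _ 0)// oppr_le0.
    by rewrite lee_fin; have := Hb n%:R; have := Hb (- n%:R); lra.
have nu_fin : fin_num_fun nu.
  move=> A mA; rewrite ge0_fin_numE//.
  rewrite (@le_lt_trans _ _ (nu setT))//; last by rewrite (le_lt_trans nuT)// ltry.
  by apply: le_measure; rewrite ?inE.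
have nu_Ny a : nu `]-oo, a]%classic = (H a)%:E.
  apply/eqP; rewrite eq_le; apply/andP; split.
    have -> : `]-oo, a]%classic = \bigcup_n `]a - n%:R, a]%classic.
      apply/seteqP; split => [x /=|x [n _] /=]; rewrite !in_itv/=; last by case/andP.
      move=> xa; exists (Num.truncn (a - x)).+1 => //=; rewrite in_itv/= xa andbT.
      by have := truncnS_gt (a - x); lra.
    apply: measure_bigcup_le => [n|m n mn|n].
    - exact: measurable_itv.
    - by apply/subsetPset/subset_itvr; rewrite bnd_simp lerD2l lerN2 ler_nat.
    - rewrite [leLHS]nu_oc; last by rewrite lerBlDr lerDl.
      by rewrite lee_fin; have := Hb (a - n%:R); lra.
  (* Since [H] takes arbitrarily small values, a bounded interval ending at [a] already carries mass
     at least [H a - e]. The minimum with [a] keeps its endpoints in order. *)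
  apply/lee_addgt0Pr => e /H0[x xe].
  have := nu_oc (Num.min x a) a; rewrite ge_min lexx orbT => /(_ erefl) E.
  apply: (@le_trans _ _ (nu `](Num.min x a), a]%classic + e%:E)%E).
    rewrite E -EFinD lee_fin.
    have : H (Num.min x a) <= H x by apply: (ndH _ _); rewrite ge_min lexx.
    by lra.
  apply: leeD => //; apply: le_measure; rewrite ?inE//; exact: subset_itvr.
pose nuF : {finite_measure set (measurableTypeR R) -> \bar R} :=
  HB.pack nu (Measure_isFinite.Build _ _ _ nu nu_fin).
have nu_dom : nuF `<< leb.
  apply/null_content_dominatesP => A mA A0.
  by apply/eqP; rewrite eq_le measure_ge0 andbT -A0; exact: nu_leb.
have [g [g0 gfin intg nuE]] := radon_nikodym_sigma_finite nu_dom.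
pose h x := fine (g x).
have hE x : (h x)%:E = g x by rewrite fineK.
have inth : leb.-integrable setT (EFin \o h).
  by apply: eq_integrable intg => // x _; rewrite /= hE.
have mh : measurable_fun setT h.
  by apply/measurable_EFinP; exact: (measurable_int _ inth).
have hNy a : (\int[leb]_(x in [set` `]-oo, a]]) (h x)%:E = (H a)%:E)%E.
  by rewrite -nu_Ny [RHS]nuE//; apply: eq_integral => x _; rewrite hE.
exists h; split => // [x|D|]; first by rewrite /h fine_ge0.
  2: by apply: le_trans nuT; rewrite [leRHS]nuE// (eq_integral g) => // x _.
(* [H] is a primitive of [h], so its derivative equals [h] almost everywhere, and changing the
   integrand on a null set is harmless on any [D]. *)
have : {ae leb, forall x, derivable H x 1 /\ derive1 H x = h x}.
  have -> : H = (fun x => (\int[leb]_(t in [set` `]-oo, x]]) h t)%R).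
    by apply/funext => x; rewrite /Rintegral hNy.
  apply: FTC1Ny => [y|].
    by apply: integrableS inth.
  by apply: open_integrable_locally => //; exact: openT.
move=> [N [mN N0 HN]].
apply: (eq_integral_off_null _ mN N0) => x Nx.
have : ~ ~ (derivable H x 1 /\ derive1 H x = h x) by move=> /HN.
by move=> /contrapT[_ ->].
Qed.

End MonotoneLipschitz.

(** * Lagrangian coordinates and quantiles of a finite measure *)

Section LagrangianCoordinates.
Set Implicit Arguments.
Unset Strict Implicit.
Context {R : realType} (mu : {finite_measure set R -> \bar R}).
Local Notation F := (Fcum mu).
Local Notation C := (mass mu).
Local Notation y := (ybar0 mu).
Local Notation H := (Hbar0 mu).

Lemma FcumE x : mu [set` `]-oo, x[] = (F x)%:E.
Proof. by rewrite /Fcum fineK// fin_num_measure. Qed.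

Lemma massE : mu setT = C%:E.
Proof. by rewrite /mass fineK// fin_num_measure. Qed.

Lemma Fcum_ge0 x : 0 <= F x.
Proof. by rewrite -lee_fin -FcumE. Qed.

Lemma Fcum_le_mass x : F x <= C.
Proof. by rewrite -lee_fin -FcumE -massE le_measure ?inE. Qed.

Lemma mass_ge0 : 0 <= C. Proof. by rewrite -lee_fin -massE. Qed.

Lemma Fcum_le x z : x <= z -> F x <= F z.
Proof.
move=> xz; rewrite -lee_fin -!FcumE le_measure ?inE//.
exact: subset_itvl.
Qed.

(** The half-lines below [-n] decrease to the empty set and [mu] is finite, so a positive lower
    bound on [F] would also bound the mass of the empty set. *)
Lemma Fcum_lt e : 0 < e -> exists x, F x < e.
Proof.
move=> e0; apply: contrapT => /forallNP Fe.
suff : (e%:E <= mu set0)%E by rewrite measure0 lee_fin leNgt e0.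
rewrite -(_ : \bigcap_n [set` `]-oo, - n%:R[] = set0 :> set R); last first.
  apply/seteqP; split => // x /(_ (Num.truncn (- x)).+1 Logic.I) /=.
  by rewrite in_itv/= ltrNr ltNge => /negP; apply; exact/ltW/truncnS_gt.
apply: measure_bigcap_ge => // [m n mn||n].
- by apply/subsetPset/subset_itvl; rewrite bnd_simp lerN2 ler_nat.
- by rewrite ltey_eq fin_num_measure.
- by rewrite /= FcumE lee_fin leNgt; apply/negP/Fe.
Qed.

Lemma Fcum_gt c : c < C -> exists x, c < F x.
Proof.
move=> cC; apply: contrapT => /forallNP Fe.
suff : (mu setT <= c%:E)%E by rewrite massE lee_fin leNgt cC.
rewrite -(_ : \bigcup_n [set` `]-oo, n%:R[] = setT :> set R); last first.
  apply/seteqP; split => // x _; exists (Num.truncn x).+1 => //=.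
  by rewrite in_itv/=; exact/truncnS_gt.
apply: measure_bigcup_le => // [m n mn|n].
- by apply/subsetPset/subset_itvl; rewrite bnd_simp ler_nat.
- by rewrite /= FcumE lee_fin leNgt; apply/negP/Fe.
Qed.

Let ybar0_has_ubound xi : has_ubound [set x | x + F x < xi].
Proof. by exists xi => x /=; have := Fcum_ge0 x; lra. Qed.

Let ybar0_nonempty xi : [set x | x + F x < xi] !=set0.
Proof.
by exists (xi - C - 1) => /=; have := Fcum_le_mass (xi - C - 1); lra.
Qed.

Lemma ybar0_ge xi x : x + F x < xi -> x <= y xi.
Proof. by move=> h; apply: ub_le_sup. Qed.

Lemma ybar0_le xi x : (forall z, z + F z < xi -> z <= x) -> y xi <= x.
Proof. by move=> h; apply: ge_sup. Qed.

(** Monotonicity of [F] makes the set under the supremum downward closed, so it contains every point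
    strictly below its supremum. *)
Lemma ybar0_gt xi z : z < y xi -> z + F z < xi.
Proof.
move=> /sup_gt -/(_ (ybar0_nonempty xi))[w /= wxi zw].
by have := Fcum_le (ltW zw); lra.
Qed.

Lemma ybar0_lt xi z : y xi < z -> xi <= z + F z.
Proof. by move=> yz; rewrite leNgt; apply/negP => /ybar0_ge; lra. Qed.

Lemma ybar0_nd a b : a <= b -> y a <= y b.
Proof.
move=> ab; apply: ybar0_le => z za; apply: ybar0_ge.
exact: lt_le_trans za ab.
Qed.

(** Equivalently, [y] is 1-Lipschitz: shifting a point admissible for [b] left by [b - a] makes it
    admissible for [a], because [F] does not increase under the shift. *)
Lemma Hbar0_nd a b : a <= b -> H a <= H b.
Proof.
move=> ab; rewrite /Hbar0.
suff : y b <= y a + (b - a) by lra.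
apply: ybar0_le => z zb; suff : z - (b - a) <= y a by lra.
have h : z - (b - a) <= z by lra.
have h2 := Fcum_le h.
apply: ybar0_ge.
by have zb' : z + F z < b by []; lra.
Qed.

Lemma Hbar0_lip a b : a <= b -> H b - H a <= b - a.
Proof. by move=> /ybar0_nd; rewrite /Hbar0; lra. Qed.

Lemma Hbar0_bounds xi : 0 <= H xi <= C.
Proof.
rewrite /Hbar0; apply/andP; split.
  by rewrite subr_ge0; apply: ybar0_le => z; have := Fcum_ge0 z; lra.
suff : xi - C <= y xi by lra.
apply/ler_addgt0Pr => e e0; rewrite -lerBlDr; apply: ybar0_ge.
by have := Fcum_le_mass (xi - C - e); lra.
Qed.

Let seq_near0 (e : R) m n : 0 < e -> (m <= n)%N -> e / n.+1%:R <= e / m.+1%:R.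
Proof. by move=> e0 mn; rewrite ler_pM2l// lef_pV2 ?posrE// ler_nat. Qed.

Let seq_small (e d : R) : 0 < e -> 0 < d -> exists n, e / n.+1%:R < d.
Proof.
move=> e0 d0; exists (Num.truncn (e / d)).
by rewrite ltr_pdivrMr// mulrC -ltr_pdivrMr//; exact: truncnS_gt.
Qed.

Let seq_le1 (e : R) n : 0 < e -> e / n.+1%:R <= e.
Proof. by move=> e0; rewrite ler_pdivrMr// ler_peMr ?ler1n// ltW. Qed.

(** At an atom [y xi], [H xi] may lie anywhere in the jump of the distribution function; this bound
    and the next one bracket it. Here the half-line is exhausted from the left by points [y xi - d],
    where [F] is below [H xi + d]. *)
Lemma Hbar0_ge_Fcum xi : F (y xi) <= H xi.
Proof.
apply/ler_addgt0Pr => e e0; rewrite -lee_fin -FcumE.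
have -> : [set` `]-oo, y xi[] = \bigcup_n [set` `]-oo, y xi - e / n.+1%:R[] :> set R.
  apply/seteqP; split => [x /=|x [n _] /=]; rewrite !in_itv/=; last first.
    by move=> h; rewrite (lt_le_trans h)// lerBlDr lerDl divr_ge0// ltW.
  move=> xy; have [|n hn] := @seq_small e (y xi - x) e0; first by rewrite subr_gt0.
  by exists n => //=; rewrite in_itv/= ltrBrDr -ltrBrDl.
apply: measure_bigcup_le => // [m n mn|n].
- by apply/subsetPset/subset_itvl; rewrite bnd_simp lerB// seq_near0.
- rewrite /= FcumE lee_fin; have h := seq_le1 n e0.
  have h0 : 0 < e / n.+1%:R by rewrite divr_gt0.
  move: (e / n.+1%:R) h h0 => d h h0.
  have /ybar0_gt : y xi - d < y xi by lra.
  by rewrite /Hbar0; lra.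
Qed.

(** The closed half-line is approached from the right by points [y xi + d], where [F] is at least
    [H xi - d]. *)
Lemma Hbar0_le_closed xi : ((H xi)%:E <= mu [set` `]-oo, y xi]])%E.
Proof.
apply/lee_addgt0Pr => e e0; rewrite -leeBlDr// -EFinB.
have -> : [set` `]-oo, y xi]] = \bigcap_n [set` `]-oo, y xi + e / n.+1%:R[] :> set R.
  apply/seteqP; split => [x /= + n _ /=|x h /=]; rewrite !in_itv/=.
    by move=> h; rewrite (le_lt_trans h)// ltrDl divr_gt0.
  rewrite leNgt; apply/negP => xy.
  have [|n hn] := @seq_small e (x - y xi) e0; first by rewrite subr_gt0.
  by have := h n Logic.I; rewrite /= in_itv/= -ltrBlDl ltNge (ltW hn).
apply: measure_bigcap_ge => // [m n mn||n].
- by apply/subsetPset/subset_itvl; rewrite bnd_simp lerD2l seq_near0.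
- by rewrite ltey_eq fin_num_measure.
- rewrite /= FcumE lee_fin; have h := seq_le1 n e0.
  have h0 : 0 < e / n.+1%:R by rewrite divr_gt0.
  move: (e / n.+1%:R) h h0 => d h h0.
  have /ybar0_lt : y xi < y xi + d by lra.
  by rewrite /Hbar0; lra.
Qed.

(** Subtract the two brackets of [H]. The interval is open at both ends because [H] may count only a
    part of an atom sitting at an endpoint. *)
Lemma mu_itv_oo_le xi1 xi2 :
  xi1 <= xi2 -> (mu [set` `]y xi1, y xi2[] <= (H xi2 - H xi1)%:E)%E.
Proof.
move=> xi12; have [y12|y21] := ltP (y xi1) (y xi2); last first.
  by rewrite set_itv_ge ?bnd_simp -?leNgt// measure0 lee_fin subr_ge0 Hbar0_nd.
rewrite EFinB leeBrDr//.
apply: (@le_trans _ _ (mu [set` `]-oo, y xi2[])).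
  rewrite (@itv_bndbnd_setU _ _ -oo%O (BRight (y xi1)))// ?bnd_simp//.
  rewrite measureU//; last first.
    apply/seteqP; split => // x [] /=; rewrite !in_itv/= => xle /andP[].
    by rewrite ltNge xle.
  by rewrite addeC leeD2r// Hbar0_le_closed.
by rewrite FcumE lee_fin Hbar0_ge_Fcum.
Qed.

Lemma Fcum_lt_chi eta x : 0 < eta < C -> x < chi mu eta -> F x < eta.
Proof.
move=> /andP[eta0 etaC]; have [z ze] := Fcum_lt eta0.
move=> /sup_gt[|w /=]; first by exists z; rewrite /= FcumE lte_fin.
by rewrite FcumE lte_fin => we xw; rewrite (le_lt_trans _ we)// Fcum_le// ltW.
Qed.

Lemma Fcum_ge_chi eta x : 0 < eta < C -> chi mu eta < x -> eta <= F x.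
Proof.
move=> /andP[eta0 etaC]; have [z ze] := Fcum_gt etaC.
rewrite leNgt => + ; apply: contraPN => Fx; apply/negP; rewrite -leNgt.
apply: ub_le_sup; last by rewrite /= FcumE lte_fin.
exists z => w /=; rewrite FcumE lte_fin => we; rewrite leNgt; apply/negP => zw.
by have := Fcum_le (ltW zw); lra.
Qed.

(** The function [x + F x] crosses the level [chi mu eta + eta] at [chi mu eta], since [F] is below
    [eta] to the left of that point and at least [eta] to the right. *)
Lemma ybar0_chi eta : 0 < eta < C -> y (chi mu eta + eta) = chi mu eta.
Proof.
move=> etaC; apply/eqP; rewrite eq_le; apply/andP; split.
  apply: ybar0_le => z; apply: contraTT; rewrite -!ltNge -leNgt => zx.
  by have := Fcum_ge_chi etaC zx; lra.
apply/ler_addgt0Pr => e e0; rewrite -lerBlDr; apply: ybar0_ge.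
by have := @Fcum_lt_chi _ (chi mu eta - e) etaC; lra.
Qed.

Lemma Hbar0_chi eta : 0 < eta < C -> H (chi mu eta + eta) = eta.
Proof. by move=> h; rewrite /Hbar0 ybar0_chi//; lra. Qed.

(** If [y xi] is left of the quantile, [H xi] is at most [F] at the midpoint between them, which is
    still below [eta]. Otherwise the bound on [xi] gives the claim directly. The strictness makes
    [chi mu eta + eta] the first point where [H] reaches [eta]. *)
Lemma Hbar0_lt_chi eta xi : 0 < eta < C -> xi < chi mu eta + eta -> H xi < eta.
Proof.
move=> etaC xilt; have [yx|xy] := ltP (y xi) (chi mu eta).
  have ym : y xi < (y xi + chi mu eta) / 2 by lra.
  have mx : (y xi + chi mu eta) / 2 < chi mu eta by lra.
  have := Fcum_lt_chi etaC mx; have := Hbar0_le_closed xi.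
  move=> /le_trans H1 /=; apply: le_lt_trans.
  rewrite -lee_fin -FcumE; apply: H1; apply: le_measure; rewrite ?inE//.
  exact: subset_itvl.
by rewrite /Hbar0; lra.
Qed.

Lemma chi_nd eta eta' : 0 < eta < C -> 0 < eta' < C -> eta <= eta' ->
  chi mu eta <= chi mu eta'.
Proof.
move=> h h' le; rewrite leNgt; apply/negP => lt.
have := @Fcum_lt_chi _ ((chi mu eta + chi mu eta') / 2) h.
have := @Fcum_ge_chi _ ((chi mu eta + chi mu eta') / 2) h'.
by lra.
Qed.

(** [H] attains each level [eta] strictly between 0 and [C], at [chi mu eta + eta]. When [C = 0]
    there is no such level, but then [H] vanishes. *)
Lemma Hbar0_lt e : 0 < e -> exists xi, H xi < e.
Proof.
move=> e0; have := mass_ge0; rewrite le_eqVlt => /predU1P[C0|C0].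
  by exists 0; have := Hbar0_bounds 0; lra.
pose eta := Num.min (e / 2) (C / 2).
have etae : eta < e by rewrite gt_min; apply/orP; left; lra.
have etaC : 0 < eta < C.
  by rewrite lt_min gt_min; apply/andP; split; [lra|apply/orP; right; lra].
by exists (chi mu eta + eta); rewrite Hbar0_chi.
Qed.

Lemma Hbar0_gt c : c < C -> exists xi, c < H xi.
Proof.
move=> cC; have := mass_ge0; rewrite le_eqVlt => /predU1P[C0|C0].
  by exists 0; have := Hbar0_bounds 0; lra.
pose eta := Num.max ((c + C) / 2) (C / 2).
have etae : c < eta by rewrite lt_max; apply/orP; left; lra.
have etaC : 0 < eta < C.
  by rewrite gt_max lt_max; apply/andP; split; [apply/orP; right; lra|lra].
by exists (chi mu eta + eta); rewrite Hbar0_chi.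
Qed.

End LagrangianCoordinates.

(** * The energy inequality and regularity of the Lagrangian variables *)

Section ConservativeSolution.
Set Implicit Arguments.
Unset Strict Implicit.
Context {R : realType}.
Local Notation leb := (@lebesgue_measure R).

Lemma H1_sq_integrable (u du : R -> R) (D : set R) : H1_with_deriv u du ->
  measurable D -> leb.-integrable D (fun x => ((du x) ^+ 2)%:E).
Proof.
move=> [mdu [_ [idu _]]] mD; apply: (@integrableS _ _ _ _ setT) => //.
apply/integrableP; split.
  by apply/measurable_EFinP; exact: measurable_funX.
by under eq_integral do rewrite gee0_abs ?lee_fin ?sqr_ge0//.
Qed.

(* Expand [0 <= \int (1 + s * du)^2] over [`]a, b[]. *)
Lemma H1_increment (u du : R -> R) (a b K s : R) : H1_with_deriv u du -> a <= b ->
  (\int[leb]_(x in [set` `]a, b[]) ((du x) ^+ 2)%:E <= K%:E)%E ->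
  0 <= (b - a) + 2 * s * (u b - u a) + s ^+ 2 * K.
Proof.
move=> H1 ab duK; have [mdu [_ [_ uE]]] := H1.
pose D : set (measurableTypeR R) := [set` `]a, b[].
have mD : measurable D by exact: measurable_itv.
have lebD : leb D = (b - a)%:E.
  rewrite /D lebesgue_measure_itv/= lte_fin; case: ltP => // ba.
  by rewrite (@le_anti _ _ a b) ?subrr// ab.
have isq : leb.-integrable D (fun x => ((du x) ^+ 2)%:E).
  exact: H1_sq_integrable H1 mD.
have i1 : leb.-integrable D (fun x => 1%:E).
  apply/integrableP; split; first exact: measurable_cst.
  rewrite (eq_integral (cst 1%:E)); last by move=> x _; rewrite /= normr1.
  by rewrite integral_cst// [X in (_ * X)%E]lebD mul1e ltry.
(* On a bounded interval integrability follows from [|du| <= 1 + du ^+ 2]. *)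
have idu : leb.-integrable D (fun x => (du x)%:E).
  have i2 := integrableD mD i1 isq.
  apply: le_integrable i2 => //.
    by apply/measurable_EFinP; exact: measurable_funS mdu.
  move=> x _ /=; rewrite lee_fin (@ger0_norm _ (1 + _)) ?addr_ge0 ?sqr_ge0//.
  rewrite -(@real_normK _ (du x)) ?num_real//.
  by have := sqr_ge0 (`|du x| - 1); have := normr_ge0 (du x); nra.
have uE' : (u b - u a)%:E = (\int[leb]_(x in D) (du x)%:E)%E.
  have mdu' E : measurable_fun E (EFin \o du).
    by apply/measurable_EFinP; exact: measurable_funS mdu.
  rewrite uE// -integral_itv_bndo_bndc; last exact: mdu'.
  by rewrite -integral_itv_obnd_cbnd; last exact: mdu'.
have : (0 <= \int[leb]_(x in D)
    (1%:E + ((2 * s)%:E * (du x)%:E + (s ^+ 2)%:E * ((du x) ^+ 2)%:E)))%E.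
  apply: integral_ge0 => x _; rewrite -!EFinM -!EFinD lee_fin.
  by have := sqr_ge0 (1 + s * du x); congr (_ <= _); ring.
rewrite integralD//; last by apply: integrableD => //; exact: integrableZl.
rewrite integralD//; [|exact: integrableZl|exact: integrableZl].
rewrite !integralZl// -uE' integral_cst// [X in (_ * X)%E]lebD mul1e.
set I := (\int[leb]_(x in D) _)%E in duK *.
have If : I \is a fin_num by exact: integrable_fin_num.
rewrite -(fineK If) in duK *; rewrite -!EFinM -!EFinD !lee_fin in duK *.
by move=> /le_trans; apply; rewrite addrA lerD2l ler_wpM2l ?sqr_ge0.
Qed.

Context (u0 du0 : R -> R) (mu0 : {finite_measure set R -> \bar R}).
Hypothesis u0H1 : H1_with_deriv u0 du0.
Hypothesis mu0ac : ac_part_is mu0 du0.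
Local Notation C := (mass mu0).
Local Notation y := (ybar0 mu0).
Local Notation H := (Hbar0 mu0).
Local Notation U := (Ubar0 u0 mu0).

Lemma ac_part_le (A : set R) : measurable A ->
  (\int[leb]_(x in A) ((du0 x) ^+ 2)%:E <= mu0 A)%E.
Proof. by move=> mA; have [nu [_ ->]] := mu0ac; rewrite ?leeDl. Qed.

Lemma Ubar0_increment (s a b : R) : a <= b ->
  0 <= (y b - y a) + 2 * s * (U b - U a) + s ^+ 2 * (H b - H a).
Proof.
move=> ab; apply: (H1_increment _ u0H1); first exact: ybar0_nd.
by rewrite (le_trans (ac_part_le _))// mu_itv_oo_le.
Qed.

Lemma Ubar0_lip a b : a <= b -> `|U b - U a| <= 2^-1 * (b - a).
Proof.
move=> ab; have := Ubar0_increment 1 ab; have := Ubar0_increment (-1) ab.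
by rewrite ler_norml /Hbar0 => h1 h2; apply/andP; split; lra.
Qed.

Lemma ybar_nd t a b : a <= b -> ybar u0 mu0 t a <= ybar u0 mu0 t b.
Proof. by move=> ab; have := Ubar0_increment (t / 2) ab; rewrite /ybar; nra. Qed.

(** The constant adds the contributions of the three terms of [ybar]: [H] and [y] are 1-Lipschitz
    and [U] is 1/2-Lipschitz. *)
Lemma ybar_lip t a b : 0 <= t -> a <= b ->
  ybar u0 mu0 t b - ybar u0 mu0 t a <= (t ^+ 2 / 4 + t / 2 + 1) * (b - a).
Proof.
move=> t0 ab; have := Ubar0_lip ab; rewrite ler_norml => /andP[_ hU].
have hH := Hbar0_lip mu0 ab; have hy : y b - y a <= b - a.
  by have := Hbar0_nd mu0 ab; rewrite /Hbar0; lra.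
have tH : t ^+ 2 * (H b - H a) <= t ^+ 2 * (b - a) by rewrite ler_wpM2l ?sqr_ge0.
have tU : t * (U b - U a) <= t * (2^-1 * (b - a)) by rewrite ler_wpM2l.
by rewrite /ybar; lra.
Qed.

(** Without mass there is no energy on any interval, so [u0] is constant, and a nonzero constant is
    not square integrable on the line. *)
Lemma H1_zero_mass : C = 0 -> forall x, u0 x = 0.
Proof.
move=> C0; have mu00 A : measurable A -> mu0 A = 0%E.
  move=> mA; apply/eqP; rewrite eq_le measure_ge0 andbT -[leRHS]/(0%:E) -C0.
  by rewrite -massE le_measure ?inE.
have u0_cst a b : a <= b -> u0 b = u0 a.
  move=> ab; have du00 : (\int[leb]_(x in [set` `]a, b[]) ((du0 x) ^+ 2)%:E <= 0%:E)%E.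
    by rewrite -[leRHS](mu00 [set` `]a, b[])//; exact: ac_part_le.
  apply/eqP; rewrite -subr_eq0; apply: contraT => d0.
  (* With [K = 0] the inequality is affine in [s]; this [s] gives its right-hand side the value
     -1. *)
  have := H1_increment (- (b - a + 1) / (2 * (u0 b - u0 a))) u0H1 ab du00.
  rewrite mulr0 addr0 (_ : 2 * _ * _ = - (b - a + 1)); first by lra.
  by field.
have u0E x : u0 x = u0 0.
  by have [/u0_cst|/ltW/u0_cst ->] := leP 0 x.
suff u00 : u0 0 = 0 by move=> x; rewrite u0E.
have [_ [+ _]] := u0H1; under eq_integral do rewrite u0E.
rewrite integral_cst//; apply: contraPP => /eqP u00.
have lebT : leb setT = +oo%E by rewrite -set_itvNyy lebesgue_measure_itv.
by rewrite [X in (_ * X)%E]lebT gt0_muley ?ltxx// lte_fin exprn_even_gt0.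
Qed.

End ConservativeSolution.

(** * Quantiles and velocities of the solution at time [t] *)

Section ExplicitSolution.
Set Implicit Arguments.
Unset Strict Implicit.
Context {R : realType} (u0 du0 : R -> R) (mu0 : {finite_measure set R -> \bar R}).
Context (u : R -> R -> R) (mu : R -> set R -> \bar R).
Hypothesis u0H1 : H1_with_deriv u0 du0.
Hypothesis mu0ac : ac_part_is mu0 du0.
Hypothesis sol : conservative_solution u0 mu0 u mu.
Context (t : R).
Hypothesis t0 : 0 <= t.
Local Notation leb := (@lebesgue_measure R).
Local Notation C := (mass mu0).
Local Notation H := (Hbar0 mu0).
Local Notation yt := (ybar u0 mu0 t).

(** The preimage of a left half-line under the nondecreasing [yt] is contained in, or contains, the
    half-line up to [a], whose mass is [H a]. Two one-sided bounds are used because [yt] may be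
    constant on intervals. *)
Lemma solution_cdf : [/\ forall A, measurable A -> (0 <= mu t A)%E,
  forall x a, x <= yt a -> (mu t [set` `]-oo, x[] <= (H a)%:E)%E,
  forall x a, yt a < x -> ((H a)%:E <= mu t [set` `]-oo, x[])%E &
  mu t setT = C%:E].
Proof.
have [_ muE] := sol t0.
have ytnd a b : a <= b -> yt a <= yt b by exact: (ybar_nd u0H1 mu0ac t).
have [h [mh h0 hE hNy hT]] := nondecreasing_lipschitz_density (Hbar0_nd mu0)
  (Hbar0_lip mu0) (Hbar0_bounds mu0) (Hbar0_lt mu0).
have h0' (D : set R) x : D x -> (0 <= (h x)%:E)%E by rewrite lee_fin.
have mD x : measurable (yt @^-1` [set` `]-oo, x[]).
  apply: is_interval_measurable => a b /= _; rewrite !in_itv/= => bx c /andP[_ cb].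
  by rewrite in_itv/= (le_lt_trans (ytnd _ _ cb)).
have mh' (D : set R) : measurable_fun D (EFin \o h).
  by apply/measurable_EFinP; exact: measurable_funS mh.
split.
- by move=> A mA; rewrite muE// hE; apply: integral_ge0 => x _; rewrite lee_fin.
- move=> x a xa; rewrite muE// hE -hNy.
  apply: ge0_subset_integral => //; [exact: mD|exact: mh'|exact: h0'|].
  move=> b /=; rewrite !in_itv/= => bx; rewrite leNgt; apply/negP => /ltW/ytnd.
  by move: bx xa; lra.
- move=> x a ax; rewrite muE// hE -hNy.
  apply: ge0_subset_integral => //; [exact: mD|exact: mh'|exact: h0'|].
  by move=> b /=; rewrite !in_itv/= => /ytnd ba; rewrite (le_lt_trans ba).
(* If the total integral were below [C], some [H a] would exceed it, although [H a] is the integral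
   over a smaller set. *)
- rewrite muE// hE preimage_setT; apply/eqP; rewrite eq_le hT /= leNgt.
  apply/negP => ltC; have := @Hbar0_gt _ mu0 (fine (\int[leb]_x (h x)%:E)%E).
  have Ige0 : (0 <= \int[leb]_x (h x)%:E)%E by apply: integral_ge0 => x; exact: h0'.
  have If : (\int[leb]_x (h x)%:E)%E \is a fin_num.
    by rewrite ge0_fin_numE// (lt_trans ltC)// ltry.
  rewrite -lte_fin fineK// => /(_ ltC)[a]; rewrite -lte_fin fineK// -hNy.
  rewrite ltNge => /negP; apply; apply: ge0_subset_integral => //; first exact: mh'.
  exact: h0'.
Qed.

(** The set under the supremum contains every point left of [yt xi] and none right of it. The first
    half relies on [H] being strictly below [eta] before [xi]. *)
Lemma chi_solution eta : 0 < eta < C -> chi (mu t) eta = yt (chi mu0 eta + eta).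
Proof.
move=> etaC; have [_ cdf_le cdf_ge _] := solution_cdf.
set xi := chi mu0 eta + eta.
have Hxi : H xi = eta by exact: Hbar0_chi.
pose A := [set x | (mu t [set` `]-oo, x[] < eta%:E)%E].
have ltA x : x < yt xi -> A x.
  move=> xlt; pose L := t ^+ 2 / 4 + t / 2 + 1.
  have L0 : 0 < L.
    by rewrite ltr_wpDl// addr_ge0// divr_ge0// sqr_ge0.
  (* By the Lipschitz bound, moving left from [xi] by this [d] lowers [yt] by at most [yt xi - x],
     so [yt] stays at or above [x]. *)
  pose d := (yt xi - x) / L.
  have d0 : 0 < d by rewrite divr_gt0// subr_gt0.
  have dle : xi - d <= xi by lra.
  have xd : x <= yt (xi - d).
    have Ld : L * (xi - (xi - d)) = yt xi - x.
      by rewrite /d; field; rewrite gt_eqF.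
    by have := ybar_lip u0H1 mu0ac t0 dle; rewrite -/L Ld; lra.
  rewrite /A /=; apply: le_lt_trans (cdf_le _ _ xd) _; rewrite lte_fin.
  by apply: Hbar0_lt_chi => //; rewrite -/xi ltrBlDr ltrDl.
have Ale x : A x -> x <= yt xi.
  rewrite /A /= leNgt => Ax; apply/negP => /cdf_ge; rewrite Hxi.
  by move=> /le_lt_trans/(_ Ax); rewrite ltxx.
apply/eqP; rewrite eq_le; apply/andP; split.
  by apply: ge_sup => //; exists (yt xi - 1); apply: ltA; lra.
apply/ler_addgt0Pr => e e0; rewrite -lerBlDr; apply: ub_le_sup.
  by exists (yt xi).
by apply: ltA; lra.
Qed.

(** No half-line has negative mass, so the supremum is over the empty set, where it is 0 by
    convention. *)
Lemma chi0 (nu : set R -> \bar R) :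
  (forall A, measurable A -> (0 <= nu A)%E) -> chi nu 0 = 0.
Proof.
move=> nu0; rewrite /chi (_ : [set _ | _] = set0) ?sup0//.
by apply/seteqP; split => // x /=; rewrite ltNge nu0.
Qed.

Lemma mass_solution : mass (mu t) = C.
Proof. by have [_ _ _ muT] := solution_cdf; rewrite /mass muT. Qed.

(* When [C = 0] both sides are junk-value conventions ([sup set0 = 0]), which
   are consistent because then [u0 = 0]. *)
Lemma solution_profile e : 0 < e < 1 ->
  chi (mu t) (C * e) =
    chi mu0 (C * e) + t * Ucal u0 mu0 (C * e) + t ^+ 2 / 4 * (C * (e - 2^-1)) /\
  Ucal (u t) (mu t) (C * e) =
    Ucal u0 mu0 (C * e) + t / 2 * (C * (e - 2^-1)).
Proof.
move=> /andP[e0 e1]; have [uE _] := sol t0.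
have := mass_ge0 mu0; rewrite le_eqVlt => /predU1P[C0|C0].
  have u00 := H1_zero_mass u0H1 mu0ac (esym C0).
  have [mu_ge0 _ _ _] := solution_cdf.
  have y0 : ybar0 mu0 0 = 0.
    by have := Hbar0_bounds mu0 0; rewrite /Hbar0 -C0; lra.
  have yt0 : yt 0 = 0 by rewrite /ybar /Hbar0 /Ubar0 y0 u00 -C0; ring.
  have ut0 : u t 0 = Ubar u0 mu0 t 0 by rewrite -uE yt0.
  rewrite /Ucal -C0 !mul0r !chi0// !u00 ut0.
  by rewrite /Ubar /Hbar0 /Ubar0 y0 u00 -C0; split; ring.
have eC : 0 < C * e < C by rewrite mulr_gt0//= gtr_pMr.
(* At this Lagrangian point [H] equals [C * e], so [H - C / 2] becomes [C * (e - 2^-1)]. *)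
rewrite /Ucal (chi_solution eC) uE.
by rewrite /ybar /Ubar /Ubar0 Hbar0_chi// ybar0_chi//; split; field.
Qed.

(** By monotonicity of the quantile, preimages of right half-lines are intervals. *)
Lemma chi_measurable : measurable_fun [set` `](0:R), 1[] (fun e => chi mu0 (C * e)).
Proof.
have := mass_ge0 mu0; rewrite le_eqVlt => /predU1P[C0|C0].
  rewrite (_ : (fun e => _) = cst (chi mu0 0)); first exact: measurable_cst.
  by apply/funext => e; rewrite -C0 mul0r.
apply: (measurability (@RGenCInfty.G R)) => [|/= _ [_] [r] -> <-].
  exact: RGenCInfty.measurableE.
apply: is_interval_measurable => a b /= [].
rewrite !in_itv/= !andbT => /andP[a0 a1] ra [/andP[b0 b1] rb] c /andP[ac cb].
have c01 : 0 < c < 1 by rewrite (lt_le_trans a0 ac) (le_lt_trans cb b1).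
split; rewrite /= in_itv/= ?c01// andbT (le_trans ra)// chi_nd ?ler_pM2l//.
- by rewrite mulr_gt0//= gtr_pMr.
- by rewrite mulr_gt0 ?gtr_pMr//; case/andP: c01.
Qed.

(** In Lagrangian form this is the Lipschitz function [U] composed with [chi mu0 eta + eta], a
    measurable function of [e]. *)
Lemma Ucal_measurable :
  measurable_fun [set` `](0:R), 1[] (fun e => Ucal u0 mu0 (C * e)).
Proof.
have := mass_ge0 mu0; rewrite le_eqVlt => /predU1P[C0|C0].
  rewrite (_ : (fun e => _) = cst (Ucal u0 mu0 0)); first exact: measurable_cst.
  by apply/funext => e; rewrite -C0 mul0r.
apply: (eq_measurable_fun (fun e => Ubar0 u0 mu0 (chi mu0 (C * e) + C * e))).
  move=> e; rewrite inE/= in_itv/= => /andP[e0 e1].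
  by rewrite /Ubar0 ybar0_chi// mulr_gt0//= gtr_pMr.
apply: measurableT_comp.
  apply: continuous_measurable_fun.
  exact: continuous_of_lipschitz (Ubar0_lip u0H1 mu0ac).
by apply: measurable_funD; [exact: chi_measurable|exact: measurable_funM].
Qed.

End ExplicitSolution.

(** * Growth of the sup and integral norms *)

Section DistanceEstimate.
Set Implicit Arguments.
Unset Strict Implicit.
Context {R : realType}.
Local Notation leb := (@lebesgue_measure R).

(* [A] may be non-measurable: [lebesgue_measure] is an outer measure. *)
Lemma lebesgue_null_subset (A B : set R) : A `<=` B -> leb B = 0%E -> leb A = 0%E.
Proof.
move=> AB B0; apply/eqP; rewrite eq_le; apply/andP; split.
  by rewrite -B0; exact: le_mu_ext.
exact: mu_ext_ge0.
Qed.

Lemma lebesgue_itv_open01 : leb [set` `](0:R), 1[] = 1%:E.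
Proof. by rewrite lebesgue_measure_itv/= lte_fin ltr01 oppr0 adde0. Qed.

(** For a negative [M] the exceptional set would contain the open unit interval, which has measure
    one. *)
Lemma essential_bound_ge0 (f : R -> R) (M : \bar R) :
  leb ([set` `[(0:R), 1]] `&` [set x | (M < `|f x|%:E)%E]) = 0%E -> (0 <= M)%E.
Proof.
move=> M0; rewrite leNgt; apply/negP => Mlt0.
have : leb [set` `](0:R), 1[] = 0%E.
  apply: lebesgue_null_subset M0 => x /=; rewrite !in_itv/= => /andP[x0 x1].
  by rewrite (ltW x0) (ltW x1); split => //; rewrite (lt_le_trans Mlt0) ?lee_fin.
by rewrite lebesgue_itv_open01 => -[] /eqP; rewrite oner_eq0.
Qed.

Lemma Linf01_ge0 (f : R -> R) : (0 <= Linf01 f)%E.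
Proof. by apply: le_ereal_inf_tmp => M /= /essential_bound_ge0. Qed.

Lemma L1_01_ge0 (f : R -> R) : (0 <= L1_01 f)%E.
Proof. by apply: integral_ge0 => x _; rewrite lee_fin. Qed.

(** Here [f0], [g0] stand for the initial differences of velocities and quantiles, [f], [g] for
    those at time [t], and [D] for the difference of masses. From [|x - 2^-1| <= 1/2], the sup norm
    gains [t / 4 * |D|] and the integral norm gains [t] times the sup norm plus
    [t ^+ 2 / 8 * |D|]. *)
Lemma Linf01_L1_01_growth (f0 g0 f g : R -> R) (t D : R) : 0 <= t ->
  measurable_fun [set` `](0:R), 1[] f0 -> measurable_fun [set` `](0:R), 1[] g0 ->
  (forall x, 0 < x < 1 -> f x = f0 x + t / 2 * (D * (x - 2^-1))) ->
  (forall x, 0 < x < 1 -> g x = g0 x + t * f0 x + t ^+ 2 / 4 * (D * (x - 2^-1))) ->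
  (Linf01 f + L1_01 g + `|D|%:E
    <= (1 + t + t ^+ 2 / 8)%:E * (Linf01 f0 + L1_01 g0 + `|D|%:E))%E.
Proof.
move=> t0 mf0 mg0 fE gE.
have tt : 0 <= t ^+ 2 / 8 by rewrite divr_ge0 ?sqr_ge0.
have c0 : 0 < 1 + t + t ^+ 2 / 8 by lra.
have := Linf01_ge0 f0; have := L1_01_ge0 g0.
(* If an initial norm is infinite, so is the right-hand side, its coefficient being positive. *)
case El : (Linf01 f0) => [l| |//]; case Ei : (L1_01 g0) => [i| |//]; last 3 first.
- by move=> *; rewrite addey// addye// gt0_muley ?leey ?lte_fin.
- by move=> *; rewrite addye// gt0_muley ?leey ?lte_fin.
- by move=> *; rewrite addye// gt0_muley ?leey ?lte_fin.
rewrite !lee_fin => i0 l0.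
apply/lee_addgt0Pr => e e0.
(* The essential bound [M] will enter the final sum with factor [1 + t], so this tolerance costs [e]
   in all. *)
have d0 : 0 < e / (1 + t) by rewrite divr_gt0//; lra.
have lfin : Linf01 f0 \is a fin_num by rewrite El.
have [M' /= M'0 M'l] := lb_ereal_inf_adherent d0 lfin.
rewrite -/(Linf01 f0) El -EFinD in M'l.
pose I01 : set (measurableTypeR R) := [set` `](0:R), 1[].
have mI : measurable I01 by exact: measurable_itv.
have DI x : 0 < x < 1 -> `|D * (x - 2^-1)| <= `|D| / 2.
  move=> x01; rewrite normrM ler_wpM2l// ler_norml.
  by move: x01 => /andP[x0 x1]; apply/andP; split; lra.
have M'_ge0 : (0 <= M')%E := essential_bound_ge0 M'0.
case: M' M'0 M'l M'_ge0 => [M| |//] M0 Ml M_ge0; last by rewrite ltNge leey in Ml.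
rewrite lte_fin in Ml; rewrite lee_fin in M_ge0.
(* The exceptional set is taken in the open interval, where [f0] is known to be measurable. *)
pose N := I01 `&` [set x | M < `|f0 x|].
have mN : measurable N.
  have : measurable_fun I01 (Num.norm \o f0) by exact: measurableT_comp.
  move=> /(_ mI `]M, +oo[%classic)/(_ (measurable_itv _)).
  by rewrite /N; congr (measurable (_ `&` _)); apply/seteqP; split => x /=;
    rewrite in_itv/= andbT.
have N0 : leb N = 0%E.
  apply: lebesgue_null_subset M0 => x [] /=; rewrite !in_itv/= => /andP[x0 x1] Mx.
  by rewrite (ltW x0) (ltW x1) lte_fin.
have f0M x : 0 < x < 1 -> ~ N x -> `|f0 x| <= M.
  by move=> x01 Nx; rewrite leNgt; apply/negP => Mx; apply: Nx; split => //=;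
    rewrite in_itv.
have Linf_f : (Linf01 f <= (M + t / 4 * `|D|)%:E)%E.
  apply: ereal_inf_lbound => /=.
  (* The formula for [f] is available only for [0 < x < 1], so the endpoints join the null set. *)
  apply: (@lebesgue_null_subset _ (N `|` [set 0; 1])).
    move=> x [] /=; rewrite in_itv/= lte_fin => /andP[x0 x1] fx.
    have [->|xn0] := eqVneq x 0; first by right; left.
    have [->|xn1] := eqVneq x 1; first by right; right.
    have x01 : 0 < x < 1 by rewrite !lt_neqAle x0 x1 xn1 eq_sym xn0.
    left; apply: contrapT => /(f0M _ x01) f0x; move: fx; rewrite fE//.
    have h := DI _ x01.
    apply/negP; rewrite -leNgt (le_trans (ler_normD _ _))// lerD//.
    rewrite normrM (@ger0_norm _ (t / 2)) ?divr_ge0//.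
    rewrite (le_trans (ler_wpM2l _ h)) ?divr_ge0//; lra.
  have m01 : measurable ([set 0; 1] : set (measurableTypeR R)).
    by apply: measurableU; exact: measurable_set1.
  rewrite measureU0// measureU0//; exact: lebesgue_measure_set1.
have mg : measurable_fun I01 g.
  apply: (eq_measurable_fun
    (fun x => g0 x + t * f0 x + t ^+ 2 / 4 * (D * (x - 2^-1)))).
    by move=> x; rewrite inE /I01/= in_itv/= => x01; rewrite gE.
  apply: measurable_funD; first by apply: measurable_funD => //; exact: measurable_funM.
  by apply: measurable_funM => //; apply: measurable_funM => //; exact: measurable_funB.
pose K := t * M + t ^+ 2 / 8 * `|D|.
have K0 : 0 <= K by rewrite addr_ge0// mulr_ge0.
have L1_g : (L1_01 g <= (i + K)%:E)%E.
  have mng (k : R -> R) : measurable_fun I01 k ->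
      measurable_fun I01 (fun x => `|k x|%:E).
    by move=> mk; apply/measurable_EFinP; exact: measurableT_comp.
  have L1E (k : R -> R) : measurable_fun I01 k ->
      L1_01 k = (\int[leb]_(x in I01) `|k x|%:E)%E.
    by move=> mk; apply: integral_itv_bndoo; exact: mng.
  rewrite EFinD -Ei !L1E//.
  (* Writing [K] as its own integral over an interval of length one reduces the bound to a pointwise
     comparison off [N]. *)
  rewrite -[K%:E]mule1 -lebesgue_itv_open01 -integral_cst//.
  rewrite -ge0_integralD//; last exact: mng.
  apply: ae_ge0_le_integral => //.
  - exact: mng.
  - by move=> x _; rewrite adde_ge0// lee_fin.
  - by apply: emeasurable_funD => //; exact: mng.
  exists N; split => // x /= /not_implyP[]; rewrite /I01/= in_itv/= => x01.
  apply: contra_notP => /(f0M _ x01) f0x; rewrite -EFinD lee_fin gE//.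
  have h := DI _ x01.
  rewrite -addrA (le_trans (ler_normD _ _))// lerD2l (le_trans (ler_normD _ _))//.
  rewrite lerD// normrM; first by rewrite (ger0_norm t0) ler_wpM2l.
  rewrite (@ger0_norm _ (t ^+ 2 / 4)) ?divr_ge0 ?sqr_ge0//.
  rewrite (le_trans (ler_wpM2l _ h)) ?divr_ge0 ?sqr_ge0//; lra.
apply: (le_trans (leeD (leeD Linf_f L1_g) (le_refl _))).
rewrite -!EFinD lee_fin /K.
have := normr_ge0 D; set d := `|D| => d_ge0.
have Me : (1 + t) * M <= (1 + t) * l + e.
  have -> : (1 + t) * l + e = (1 + t) * (l + e / (1 + t)).
    by field; rewrite gt_eqF//; lra.
  by rewrite ler_wpM2l ?(ltW Ml)//; lra.
have td : 0 <= t * d by rewrite mulr_ge0.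
have ti : 0 <= t * i by rewrite mulr_ge0.
have tl : 0 <= t ^+ 2 / 8 * l by rewrite mulr_ge0.
have tti : 0 <= t ^+ 2 / 8 * i by rewrite mulr_ge0.
by lra.
Qed.

End DistanceEstimate.

Theorem theorem2p2 (R : realType)
  (u01 u02 du01 du02 : R -> R)
  (mu01 mu02 : {finite_measure set R -> \bar R})
  (u1 u2 : R -> R -> R) (mu1 mu2 : R -> set R -> \bar R) :
  H1_with_deriv u01 du01 -> H1_with_deriv u02 du02 ->
  ac_part_is mu01 du01 -> ac_part_is mu02 du02 ->
  tail_condition mu01 -> tail_condition mu02 ->
  conservative_solution u01 mu01 u1 mu1 ->
  conservative_solution u02 mu02 u2 mu2 ->
  forall t : R, 0 <= t ->
    (dist (u1 t) (mu1 t) (u2 t) (mu2 t)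
     <= (1 + t + t ^+ 2 / 8)%:E * dist u01 mu01 u02 mu02)%E.
Proof.
move=> u01H1 u02H1 mu01ac mu02ac _ _ sol1 sol2 t t0.
rewrite /dist (mass_solution u01H1 mu01ac sol1 t0).
rewrite (mass_solution u02H1 mu02ac sol2 t0).
(* Both increments in time are linear in [C_j * (e - 2^-1)], so the differences satisfy the growth
   formulas with [D = mass mu01 - mass mu02]. *)
apply: Linf01_L1_01_growth => //.
- apply: measurable_funB.
  + exact: Ucal_measurable u01H1 mu01ac.
  + exact: Ucal_measurable u02H1 mu02ac.
- by apply: measurable_funB; exact: chi_measurable.
- move=> x x01.
  have [_ ->] := solution_profile u01H1 mu01ac sol1 t0 x01.
  have [_ ->] := solution_profile u02H1 mu02ac sol2 t0 x01.
  by ring.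
- move=> x x01.
  have [-> _] := solution_profile u01H1 mu01ac sol1 t0 x01.
  have [-> _] := solution_profile u02H1 mu02ac sol2 t0 x01.
  by ring.
Qed.
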